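(* Let $x^\star\in\mathbb{R}^n$ be a feasible point of (MPBVC) at which BVC-LICQ holds. Then the Guignard constraint qualification (GCQ) holds at $x^\star$, i.e. $\mathcal{L}(x^\star)^-=\mathcal{T}(X,x^\star)^-$.
   Context: Setting. Let $f,H_i,G_{i,j}:\mathbb{R}^n\to\mathbb{R}$ ($1\le i\le n_H$, $1\le j\le n_G$, with $n_H,n_G\ge1$), $g:\mathbb{R}^n\to\mathbb{R}^{n_g}$, $h:\mathbb{R}^n\to\mathbb{R}^{n_h}$ be twice continuously differentiable. (MPBVC) is the problem: minimize $f(x)$ subject to $g(x)=0$, $h(x)\ge0$, $H_i(x)\ge0$ for all $i$, and $G_{i,j}(x)H_i(x)\ge0$ for all $(i,j)$. Its feasible set is $X$. Index sets at a feasible point $x^\star$: let $\mathcal{I}_{(+,0)}$ be the set of $(i,j)$ with $H_i(x^\star)>0$, $G_{i,j}(x^\star)=0$; let $\mathcal{I}_{(0,+)},\mathcal{I}_{(0,0)},\mathcal{I}_{(0,-)}$ be the sets of $(i,j)$ with $H_i(x^\star)=0$ and $G_{i,j}(x^\star)>0$, $=0$, $<0$ respectively. For each of these, $\mathcal{I}^H_{(\cdot,\cdot)}=\{i\mid \exists j:(i,j)\in\mathcal{I}_{(\cdot,\cdot)}\}$. Let $\mathcal{I}_0^H=\{i\mid H_i(x^\star)=0\}$ and $\mathcal{I}_h=\{l\mid h_l(x^\star)=0\}$. Cones. The tangent cone is $\mathcal{T}(X,x^\star)=\{d\in\mathbb{R}^n\mid \exists\, x^{(k)}\in X,\ t^{(k)}>0,\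 t^{(k)}\to0,\ x^{(k)}\to x^\star,\ (x^{(k)}-x^\star)/t^{(k)}\to d\}$. The linearized cone $\mathcal{L}(x^\star)$ of (MPBVC) is, explicitly, the set of $d\in\mathbb{R}^n$ with $\nabla g_k(x^\star)^Td=0$ for all $k$; $\nabla h_l(x^\star)^Td\ge0$ for $l\in\mathcal{I}_h$; $\nabla H_i(x^\star)^Td=0$ for $i\in\mathcal{I}^H_{(0,-)}$; $\nabla H_i(x^\star)^Td\ge0$ for $i\in\mathcal{I}^H_{(0,0)}\cup\mathcal{I}^H_{(0,+)}$; $\nabla G_{i,j}(x^\star)^Td\ge0$ for $(i,j)\in\mathcal{I}_{(+,0)}$. The polar cone of $M\subseteq\mathbb{R}^n$ is $M^-=\{d\mid\langle d,x\rangle\le0\ \forall x\in M\}$. BVC-LICQ holds at $x^\star$ if the gradients $\nabla g_k(x^\star)$ (all $k$), $\nabla h_l(x^\star)$ ($l\in\mathcal{I}_h$), $\nabla H_i(x^\star)$ ($i\in\mathcal{I}_0^H$), $\nabla G_{i,j}(x^\star)$ ($(i,j)\in\mathcal{I}_{(0,0)}\cup\mathcal{I}_{(+,0)}$) are linearly independent. *)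

(* Defs.v *)
From HB Require Import structures.
From mathcomp Require Import all_boot all_order all_algebra.
From mathcomp Require Import all_classical all_reals all_analysis.

Set Implicit Arguments.
Unset Strict Implicit.
Unset Printing Implicit Defensive.

Import Order.TTheory GRing.Theory Num.Theory.
Import numFieldNormedType.Exports.

Local Open Scope classical_set_scope.
Local Open Scope ring_scope.

(* Points of R^n are row vectors; the sup norm carried by 'rV[R]_n induces the
   usual topology and the usual notion of differentiability. *)

Section Euclidean.
Variables (R : realType) (n : nat).
Implicit Types (phi : 'rV[R]_n -> R) (M X : set 'rV[R]_n) (x : 'rV[R]_n).

Definition inner (u v : 'rV[R]_n) : R := \sum_(i < n) u 0 i * v 0 i.

Definition partial (i : 'I_n) phi : 'rV[R]_n -> R :=
  fun x => 'D_(delta_mx 0 i) phi x.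

Definition grad phi x : 'rV[R]_n := \row_i partial i phi x.

(* phi is of class C^k: (Frechet) differentiable everywhere with a derivative,
   given by its coordinates, of class C^(k-1). *)
Fixpoint of_class_C (k : nat) phi : Prop :=
  if k is k'.+1 then
    (forall x, differentiable phi x) /\
    (forall i, of_class_C k' (partial i phi))
  else continuous phi.

Definition tangent_cone X x : set 'rV[R]_n :=
  [set d | exists (xk : nat -> 'rV[R]_n) (tk : nat -> R),
    [/\ forall k, X (xk k),
        forall k, 0 < tk k,
        tk k @[k --> \oo] --> (0 : R),
        xk k @[k --> \oo] --> x
      & (tk k)^-1 *: (xk k - x) @[k --> \oo] --> d]].

Definition polar_cone M : set 'rV[R]_n :=
  [set d | forall x, M x -> inner d x <= 0].

End Euclidean.

Record mpbvc (R : realType) (n ng nh nH nG : nat) := Mpbvc {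
  obj : 'rV[R]_n -> R;
  eqc : 'rV[R]_n -> 'rV[R]_ng;
  ineqc : 'rV[R]_n -> 'rV[R]_nh;
  Hc : 'I_nH -> 'rV[R]_n -> R;
  Gc : 'I_nH -> 'I_nG -> 'rV[R]_n -> R }.

Section Mpbvc.
Variables (R : realType) (n ng nh nH nG : nat).
Variable P : mpbvc R n ng nh nH nG.
Implicit Type x : 'rV[R]_n.

Definition eqc_comp (k : 'I_ng) : 'rV[R]_n -> R := fun x => eqc P x 0 k.
Definition ineqc_comp (l : 'I_nh) : 'rV[R]_n -> R := fun x => ineqc P x 0 l.

Definition mpbvc_C2 : Prop :=
  [/\ of_class_C 2 (obj P),
      forall k, of_class_C 2 (eqc_comp k),
      forall l, of_class_C 2 (ineqc_comp l),
      forall i, of_class_C 2 (Hc P i)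
    & forall i j, of_class_C 2 (Gc P i j)].

Definition feasible : set 'rV[R]_n :=
  [set x | [/\ eqc P x = 0,
               forall l, 0 <= ineqc P x 0 l,
               forall i, 0 <= Hc P i x
             & forall i j, 0 <= Gc P i j x * Hc P i x]].

Definition I_p0 x : {set 'I_nH * 'I_nG} :=
  [set ij | (0 < Hc P ij.1 x) && (Gc P ij.1 ij.2 x == 0)]%SET.
Definition I_0p x : {set 'I_nH * 'I_nG} :=
  [set ij | (Hc P ij.1 x == 0) && (0 < Gc P ij.1 ij.2 x)]%SET.
Definition I_00 x : {set 'I_nH * 'I_nG} :=
  [set ij | (Hc P ij.1 x == 0) && (Gc P ij.1 ij.2 x == 0)]%SET.
Definition I_0m x : {set 'I_nH * 'I_nG} :=
  [set ij | (Hc P ij.1 x == 0) && (Gc P ij.1 ij.2 x < 0)]%SET.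

(* The superscript H: projection of an index set onto its first coordinate. *)
Definition proj_H (A : {set 'I_nH * 'I_nG}) : {set 'I_nH} :=
  [set i | [exists j, (i, j) \in A]]%SET.

Definition I0_H x : {set 'I_nH} := [set i | Hc P i x == 0]%SET.
Definition I_h x : {set 'I_nh} := [set l | ineqc P x 0 l == 0]%SET.

Definition linearized_cone x : set 'rV[R]_n :=
  [set d | [/\ forall k, inner (grad (eqc_comp k) x) d = 0,
               forall l, l \in I_h x -> 0 <= inner (grad (ineqc_comp l) x) d,
               forall i, i \in proj_H (I_0m x) -> inner (grad (Hc P i) x) d = 0,
               forall i, i \in (proj_H (I_00 x) :|: proj_H (I_0p x))%SET ->
                 0 <= inner (grad (Hc P i) x) d
             & forall (i : 'I_nH) (j : 'I_nG), (i, j) \in I_p0 x ->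
                 0 <= inner (grad (Gc P i j) x) d]].

(* Linear independence of the family: a repeated gradient makes it fail. *)
Definition BVC_LICQ x : bool :=
  free ([seq grad (eqc_comp k) x | k : 'I_ng]
        ++ [seq grad (ineqc_comp l) x | l in I_h x]
        ++ [seq grad (Hc P i) x | i in I0_H x]
        ++ [seq grad (Gc P ij.1 ij.2) x | ij in (I_00 x :|: I_p0 x)%SET]).

Definition GCQ x : Prop :=
  polar_cone (linearized_cone x) = polar_cone (tangent_cone feasible x).

End Mpbvc.

(* Main.v *)
(** Tangent directions lie in the linearized cone by first-order expansion, so
    only the polar inclusion from right to left needs the constraint
    qualification.  Since all active gradients are independent, they can be
    prescribed freely (Lyusternik): along any direction [d] there is a curve on
    which every active constraint, including the [G] whose [H] vanishes as well,
    equals [t] times its directional derivative.  Hence [d] in the linearized cone is tangent as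
    soon as no such [G] decreases along [d] or all active [H] are stationary
    along [d], and every [d] is a sum of two such directions. *)

From HB Require Import structures.
Require Import Defs.
From mathcomp Require Import all_boot all_order all_algebra.
From mathcomp Require Import all_classical all_reals all_analysis.
From mathcomp Require Import ring lra.

Set Implicit Arguments.
Unset Strict Implicit.
Unset Printing Implicit Defensive.

Import Order.TTheory GRing.Theory Num.Theory.
Import numFieldNormedType.Exports.

Local Open Scope classical_set_scope.
Local Open Scope ring_scope.

(* This makes row vectors a [completeNormedModType], as the Banach fixed point
   theorem requires. *)
HB.instance Definition _ (R : realType) (m n : nat) :=
  NormedModule.on 'M[R]_(m, n).

(** * Inner product and sup norm *)

Section Inner.
Variables (R : realType) (n : nat).
Implicit Types u v w : 'rV[R]_n.

Lemma innerDr u v w : inner u (v + w) = inner u v + inner u w.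
Proof. by rewrite -big_split; apply: eq_bigr => i _; rewrite mxE mulrDr. Qed.

Lemma innerZr a u v : inner u (a *: v) = a * inner u v.
Proof.
by rewrite /inner mulr_sumr; apply: eq_bigr => i _; rewrite mxE mulrCA.
Qed.

Lemma innerNr u v : inner u (- v) = - inner u v.
Proof. by rewrite -scaleN1r innerZr mulN1r. Qed.

Lemma innerBr u v w : inner u (v - w) = inner u v - inner u w.
Proof. by rewrite innerDr innerNr. Qed.

Lemma innerBl u v w : inner (u - v) w = inner u w - inner v w.
Proof.
by rewrite /inner -sumrB; apply: eq_bigr => i _; rewrite !mxE mulrBl.
Qed.

Lemma coord_le_norm v i : `|v 0 i| <= `|v|.
Proof.
rewrite [leRHS]mx_normrE.
exact: (le_bigmax 0 (fun ij : 'I_1 * 'I_n => `|v ij.1 ij.2|) (0, i)).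
Qed.

Lemma rV_norm_le v e : 0 <= e -> (forall i, `|v 0 i| <= e) -> `|v| <= e.
Proof.
move=> e0 ve; rewrite [leLHS]mx_normrE.
by apply: bigmax_le => // -[i j] _ /=; rewrite ord1.
Qed.

(** Hölder's inequality: row vectors carry the sup norm, so the constant is the l1 norm of [u]. *)
Lemma inner_norm_le u v : `|inner u v| <= (\sum_i `|u 0 i|) * `|v|.
Proof.
rewrite (le_trans (ler_norm_sum _ _ _))// mulr_suml ler_sum// => i _.
by rewrite normrM ler_wpM2l ?coord_le_norm.
Qed.

End Inner.

(** * Mean value theorem and strict differentiability *)

Section StrictDifferentiability.
Variables (R : realType) (n : nat).
Implicit Types (phi : 'rV[R]_n -> R) (x v : 'rV[R]_n).

Lemma derive_inner phi x v :
  differentiable phi x -> 'D_v phi x = inner (grad phi x) v.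
Proof.
move=> dphi; rewrite deriveE// [in LHS](row_sum_delta v) linear_sum.
by apply: eq_bigr => i _; rewrite linearZ/= mxE /partial deriveE// mulrC.
Qed.

(** The one-variable mean value theorem applied to [phi] along the segment from [z] to [y]. *)
Lemma mean_value phi y z : (forall w, differentiable phi w) ->
  exists2 c : R, 0 <= c <= 1 &
    phi y - phi z = inner (grad phi (z + c *: (y - z))) (y - z).
Proof.
move=> dphi; pose f (s : R) := phi (z + s *: (y - z)).
have dline (s : R) : is_diff s (fun s : R => z + s *: (y - z)) ( *:%R^~ (y - z)).
  have := is_diffD (is_diff_cst z s) (is_diff_scalel s (y - z)).
  by rewrite add0r.
have df (s : R) :
    is_derive s 1 f (inner (grad phi (z + s *: (y - z))) (y - z)).
  have dfs : differentiable f s by exact: differentiable_comp.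
  split; first exact: diff_derivable.
  rewrite deriveE// diff_comp//= -derive_inner// deriveE//.
  by rewrite diff_val scale1r.
have [|c + ] := MVT_segment (@ler01 R) (fun s _ => df s).
  apply: continuous_subspaceT => s.
  by apply: differentiable_continuous; exact/derivable1_diffP.
rewrite in_itv /f scale1r scale0r addr0 subrKC subr0 mulr1 => c01 E.
by exists c.
Qed.

(** Differentiability at all points gives the mean value theorem on segments; with continuity of the
    partials at [x] alone, this yields strict differentiability at [x]. *)
Definition C1_at phi x :=
  (forall w, differentiable phi w) /\
  forall i, {for x, continuous (partial i phi)}.

(** By the mean value theorem the error is the inner product of [y - z] with the change of the
    gradient between [x] and a nearby point. Having both [y] and [z] free is what later makes the
    Newton map contract. *)
Lemma strict_differentiable phi x e : C1_at phi x -> 0 < e ->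
  exists2 d, 0 < d & forall y z, `|y - x| < d -> `|z - x| < d ->
    `|phi y - phi z - inner (grad phi x) (y - z)| <= e * `|y - z|.
Proof.
(* Each of the [n] partials may vary by [e / n.+1]; the successor keeps the denominator positive
   when [n] is zero. *)
move=> [dphi cphi] e0; have en0 : 0 < e / n.+1%:R by rewrite divr_gt0.
have : \forall w \near x, forall i, `|partial i phi x - partial i phi w| < e / n.+1%:R.
  have H i : \forall w \near x, `|partial i phi x - partial i phi w| < e / n.+1%:R.
    by move/cvgrPdist_lt : (cphi i); exact.
  exact: (filter_forall _ H).
move=> /nbhs_normP[d /= d0 dP]; exists d => // y z yd zd.
have [c /andP[c0 c1] ->] := mean_value y z dphi.
rewrite -innerBl (le_trans (inner_norm_le _ _))// ler_wpM2r//.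
have wd : `|x - (z + c *: (y - z))| < d.
  have -> : x - (z + c *: (y - z)) = - ((1 - c) *: (z - x) + c *: (y - x)).
    by apply/rowP => i; rewrite !mxE; ring.
  rewrite normrN (le_lt_trans (ler_normD _ _))// !normrZ.
  rewrite (ger0_norm c0) ger0_norm ?subr_ge0//.
  (* The strict bound comes from the [y] term, which disappears when [c] is zero. *)
  have [->|c_neq0] := eqVneq c 0; first by rewrite subr0 mul1r mul0r addr0.
  have : c * `|y - x| < c * d by rewrite ltr_pM2l// lt_neqAle eq_sym c_neq0.
  have : (1 - c) * `|z - x| <= (1 - c) * d by rewrite ler_wpM2l ?subr_ge0// ltW.
  by lra.
rewrite (@le_trans _ _ (\sum_(i < n) (e / n.+1%:R)))//.
  by apply: ler_sum => i _; rewrite !mxE distrC ltW// dP.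
rewrite sumr_const card_ord -[leLHS]mulr_natr mulrAC ler_pdivrMr//.
by rewrite ler_pM2l// ler_nat.
Qed.

End StrictDifferentiability.

(** * Prescribing inner products with independent vectors *)

Lemma free_right_inverse (R : realType) (n : nat) (I : eqType) (r : seq I)
    (v : I -> 'rV[R]_n) : free [seq v i | i <- r] ->
  exists B : 'M[R]_(size r, n), forall u (k : 'I_(size r)),
    inner (v (tnth (in_tuple r) k)) (u *m B) = u 0 k.
Proof.
move=> fr; pose A := \matrix_(k < size r) v (tnth (in_tuple r) k).
have /row_freeP[C AC1] : row_free A.
  apply: inj_row_free => u uA; apply/rowP => k; rewrite [RHS]mxE.
  have /freeP := fr : free (map_tuple v (in_tuple r)).
  apply; rewrite -[RHS]uA mulmx_sum_row.
  apply: eq_bigr => j _; congr (_ *: _).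
  by rewrite rowK -tnth_nth tnth_map.
(* The matrix [A] with rows [v] has the right inverse [C]; it is transposed because points are row
   vectors. *)
exists C^T => u k; transitivity ((A *m C *m u^T) k 0); last first.
  by rewrite AC1 mul1mx mxE.
rewrite -mulmxA -[C *m _]trmxK trmx_mul trmxK mxE.
by apply: eq_bigr => j _; rewrite !mxE.
Qed.

Lemma free_interpolation (R : realType) (n : nat) (I : eqType) (r : seq I)
    (v : I -> 'rV[R]_n) (c : I -> R) : free [seq v i | i <- r] ->
  exists e, forall i, i \in r -> inner (v i) e = c i.
Proof.
move=> /free_right_inverse[B BP].
exists ((\row_k c (tnth (in_tuple r) k)) *m B) => i ir.
by have /tnthP[k ->] : i \in in_tuple r by []; rewrite BP mxE.
Qed.

Lemma mulmx_norm_le (R : realType) (m n : nat) (B : 'M[R]_(m, n)) :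
  exists2 K, 0 < K & forall u : 'rV[R]_m, `|u *m B| <= K * `|u|.
Proof.
(* The summand 1 keeps [K] positive even for a zero matrix, so that it can be divided by. *)
pose K := 1 + \sum_j \sum_i `|B i j|.
have K0 : 0 < K by rewrite ltr_pwDl// sumr_ge0// => j _; rewrite sumr_ge0.
exists K => // u; apply: rV_norm_le => [|j]; first by rewrite mulr_ge0// ltW.
have -> : (u *m B) 0 j = inner (col j B)^T u.
  by rewrite mxE; apply: eq_bigr => i _; rewrite !mxE mulrC.
apply: le_trans (inner_norm_le _ _) _; apply: ler_wpM2r => //.
rewrite [leRHS](_ : _ = 1 + \sum_j \sum_i `|B i j|)// (bigD1 j)//=.
under eq_bigr do rewrite !mxE.
by rewrite addrCA lerDl addr_ge0// sumr_ge0// => k _; rewrite sumr_ge0.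
Qed.

(** * Correcting a direction onto the constraints by a fixed point *)

Section Lyusternik.
Variables (R : realType) (n : nat) (I : eqType) (r : seq I).
Variables (phi : I -> 'rV[R]_n -> R) (x : 'rV[R]_n).
Hypothesis phi_C1 : forall i, i \in r -> C1_at (phi i) x.
Hypothesis phi_free : free [seq grad (phi i) x | i <- r].

(* Fixed point of the simplified Newton map
   [u |-> u - (F (x + t d + u B) - F x - t F'(x) d)], where [B] is a right
   inverse of [F'(x)]; it contracts the ball of radius [e t / K]. *)
Lemma lyusternik_correction d e : 0 < e ->
  exists2 T, 0 < T & forall t, 0 < t < T -> exists2 y,
    `|y - (x + t *: d)| <= e * t &
    forall i, i \in r -> phi i y = phi i x + t * inner (grad (phi i) x) d.
Proof.
move=> e0; have [B BP] := free_right_inverse phi_free.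
have [K K0 KP] := mulmx_norm_le B.
pose F (k : 'I_(size r)) := phi (tnth (in_tuple r) k).
pose g k := grad (F k) x.
(* The first bound gives the Newton map the contraction factor 1/2; the second keeps its value at 0
   below [rho / 2]. *)
pose c := Num.min ((2 * K)^-1) (e / (2 * K * (`|d| + 1))).
have d1_gt0 : 0 < `|d| + 1 by rewrite ltr_wpDl.
have c0 : 0 < c by rewrite lt_min invr_gt0 divr_gt0 ?mulr_gt0.
have cK : c * K <= 2^-1.
  by rewrite -ler_pdivlMr// /c ge_min invfM lexx.
have cd : c * `|d| <= e / (2 * K).
  rewrite (@le_trans _ _ (c * (`|d| + 1)))//.
    by rewrite ler_pM2l// lerDl.
  by rewrite -ler_pdivlMr// /c ge_min (invfM (2 * K)) mulrA lexx orbT.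
have [D D0 DP] : exists2 D, 0 < D & forall y z, `|y - x| < D -> `|z - x| < D ->
    forall k, `|F k y - F k z - inner (g k) (y - z)| <= c * `|y - z|.
  have H k : \forall D \near (0 : R)^'+, forall y z,
      `|y - x| < D -> `|z - x| < D ->
      `|F k y - F k z - inner (g k) (y - z)| <= c * `|y - z|.
    have [D D0 DP] := strict_differentiable (phi_C1 (mem_tnth k (in_tuple r))) c0.
    near=> D' => y z yD zD.
    have D'D : D' < D by near: D'; exact: nbhs_right_lt.
    by apply: DP; [exact: lt_trans yD _ | exact: lt_trans zD _].
  near (0 : R)^'+ => D.
  have DP : forall k y z, `|y - x| < D -> `|z - x| < D ->
      `|F k y - F k z - inner (g k) (y - z)| <= c * `|y - z|.
    by near: D; exact: filter_forall.
  exists D => [|y z yD zD k]; last exact: DP.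
  by near: D; exact: nbhs_right_gt.
have de_gt0 : 0 < `|d| + e by rewrite ltr_wpDl.
(* For such [t] and [u] of norm at most [rho], the point [p u] is at distance at most
   [t * (|d| + e) < D] from [x]. *)
exists (D / (`|d| + e)) => [|t /andP[t0]]; first by rewrite divr_gt0.
rewrite ltr_pdivlMr// => tD.
pose p (u : 'rV[R]_(size r)) := x + t *: d + u *m B.
pose rho := e * t / K.
have rho0 : 0 < rho by rewrite divr_gt0// mulr_gt0.
have pD u : `|u| <= rho -> `|p u - x| < D.
  move=> u_rho; rewrite [p u - x]addrC /p addrA addKr.
  apply: le_lt_trans tD; rewrite mulrDr.
  rewrite (le_trans (ler_normD _ _))// lerD//.
    by rewrite normrZ gtr0_norm.
  by rewrite (le_trans (KP _))// mulrC -ler_pdivlMr// [t * e]mulrC.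
pose Phi (u : 'rV[R]_(size r)) : 'rV[R]_(size r) :=
  \row_k (u 0 k - (F k (p u) - F k x - t * inner (g k) d)).
pose U := [set u : 'rV[R]_(size r) | `|u| <= rho].
have lip u v : U u -> U v -> `|Phi u - Phi v| <= 2^-1 * `|u - v|.
  move=> Uu Uv; apply: rV_norm_le => [|k]; first by rewrite mulr_ge0.
  have puv : p u - p v = (u - v) *m B.
    by rewrite /p opprD addrACA subrr add0r mulmxBl.
  (* Since [B] is a right inverse, the linear terms cancel and [Phi u - Phi v] is, up to sign, the
     strict differentiability remainder. *)
  have := DP _ _ (pD _ Uu) (pD _ Uv) k; rewrite puv BP !mxE => H.
  have -> : u 0 k - (F k (p u) - F k x - t * inner (g k) d)
    - (v 0 k - (F k (p v) - F k x - t * inner (g k) d)) =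
    - (F k (p u) - F k (p v) - (u 0 k - v 0 k)) by ring.
  rewrite normrN (le_trans H)// (le_trans (ler_wpM2l (ltW c0) (KP _)))//.
  by rewrite mulrA ler_wpM2r.
have Phi0 : `|Phi 0| <= rho / 2.
  apply: rV_norm_le => [|k]; first by rewrite divr_ge0// ltW.
  have U0 : U 0 by rewrite /U /= normr0 ltW.
  have xD : `|x - x| < D by rewrite subrr normr0.
  have := DP _ _ (pD _ U0) xD k.
  have -> : p 0 - x = t *: d by rewrite /p mul0mx addr0 addrAC subrr add0r.
  rewrite innerZr normrZ gtr0_norm// !mxE sub0r normrN => H.
  rewrite (le_trans H)// mulrCA /rho.
  rewrite (le_trans (ler_wpM2l (ltW t0) cd))// le_eqVlt; apply/orP; left.
  by apply/eqP; field; rewrite gt_eqF.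
(* Half of [rho] comes from the contraction towards [Phi 0], the other half from [Phi 0] itself. *)
have PhiU : {homo Phi : u / U u >-> U u}.
  move=> u Uu; have U0 : U 0 by rewrite /U /= normr0 ltW.
  rewrite /U/= -(subrK (Phi 0) (Phi u)) (le_trans (ler_normD _ _))//.
  have := lip _ _ Uu U0; rewrite subr0; move: Uu Phi0; rewrite /U/=; lra.
have [|||u Uu] := @banach_fixed_point R _ U (mkfun PhiU).
- exists (2^-1)%:nng; split => /=; first by rewrite invf_lt1// ltr1n.
  by move=> [u v] [Uu Uv]; exact: lip.
- rewrite (_ : U = closed_ball 0 rho); first exact: closed_ball_closed.
  rewrite closed_ballE//.
  by apply/seteqP; split => u; rewrite /U /closed_ball_/= sub0r normrN.
- by exists 0; rewrite /U /= normr0 ltW.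
(* The fixed point equation says exactly that the constraints at [p u] take their linearized values;
   the correction [u *m B] has norm at most [K * rho = e * t]. *)
move=> /rowP fixu; exists (p u).
  rewrite /p addrAC subrr add0r (le_trans (KP _))// mulrC -ler_pdivlMr//.
move=> i ir; have /tnthP[k ik] : i \in in_tuple r by [].
have := fixu k; rewrite mxE ik -/(F k) -/(g k); lra.
Unshelve. all: by end_near. Qed.

End Lyusternik.

(** * Criteria for tangent directions and their first-order consequences *)

Section TangentCone.
Variables (R : realType) (n : nat).
Implicit Types (x d : 'rV[R]_n) (X Y : set 'rV[R]_n).

Lemma tangent_coneS X Y x :
  X `<=` Y -> tangent_cone X x `<=` tangent_cone Y x.
Proof.
by move=> XY d [xk [tk [Xxk ? ? ? ?]]]; exists xk, tk; split=> // k; exact: XY.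
Qed.

Lemma cvg_dist_harmonic (V : normedModType R) (u : nat -> V) (l : V) :
  (forall k, `|l - u k| <= harmonic k) -> u k @[k --> \oo] --> l.
Proof.
move=> ul; apply/cvgrPdist_lt => e e0; near=> k.
apply: le_lt_trans (ul k) _; near: k.
by apply: (cvgr_lt 0) => //; exact: cvg_harmonic.
Unshelve. all: by end_near. Qed.

(** Taking [e] to be [1 / (k + 1)] for each [k] gives step sizes tending to 0 and difference
    quotients within [1 / (k + 1)] of [d]. *)
Lemma tangent_cone_near X x d :
  (forall e, 0 < e -> exists2 t, 0 < t < e & exists2 y, X y &
    `|y - (x + t *: d)| <= e * t) ->
  tangent_cone X x d.
Proof.
move=> Xd.
have H (k : nat) : exists ty : R * 'rV[R]_n,
    [/\ X ty.2, 0 < ty.1 < harmonic k &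
        `|ty.2 - (x + ty.1 *: d)| <= harmonic k * ty.1].
  by have [t te [y Xy yt]] := Xd _ (harmonic_gt0 k); exists (t, y).
have [ty tyP] := choice H.
pose tk k := (ty k).1; pose xk k := (ty k).2.
have tk0 k : 0 < tk k by have [_ /andP[]] := tyP k.
have tk_cvg : tk k @[k --> \oo] --> (0 : R).
  apply: cvg_dist_harmonic => k; rewrite sub0r normrN gtr0_norm//.
  by have [_ /andP[_ /ltW]] := tyP k.
have q_cvg : (tk k)^-1 *: (xk k - x) @[k --> \oo] --> d.
  apply: cvg_dist_harmonic => k; have [_ _ yt] := tyP k.
  rewrite -(ler_pM2r (tk0 k)); apply: le_trans yt.
  rewrite -[X in _ * X <= _](gtr0_norm (tk0 k)) mulrC -normrZ scalerBr scalerA.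
  by rewrite divff ?gt_eqF// scale1r distrC opprD addrA lexx.
exists xk, tk; split => // [k|]; first by have [] := tyP k.
(* Convergence of the points follows from that of the step sizes and of the quotients. *)
have -> : xk = (fun k => x + tk k *: ((tk k)^-1 *: (xk k - x))).
  apply/funext => k; rewrite scalerA divff ?gt_eqF// scale1r.
  by rewrite addrC subrK.
rewrite -[X in _ --> X]addr0 -[X in x + X](scale0r d).
by apply: cvgD; [exact: cvg_cst|exact: cvgZ].
Qed.

(** Strict differentiability with one point at [x] bounds the remainder by a small multiple of
    [|q|], where the quotient [q] stays bounded because it converges; the other half of [e] pays for
    replacing [q] by [d]. *)
Lemma difference_quotient_cvg (phi : 'rV[R]_n -> R) x d (xk : nat -> 'rV[R]_n)
    (tk : nat -> R) : C1_at phi x -> (forall k, 0 < tk k) ->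
  xk k @[k --> \oo] --> x -> (tk k)^-1 *: (xk k - x) @[k --> \oo] --> d ->
  (tk k)^-1 * (phi (xk k) - phi x) @[k --> \oo] --> inner (grad phi x) d.
Proof.
move=> phi_C1 tk0 xkx qd; apply/cvgrPdist_lt => e e0.
pose C := \sum_i `|grad phi x 0 i|.
have C0 : 0 <= C by exact: sumr_ge0.
have d1_gt0 : 0 < `|d| + 1 by rewrite ltr_wpDl.
have eps0 : 0 < e / 2 / (`|d| + 1) by rewrite !divr_gt0.
have [D D0 DP] := strict_differentiable phi_C1 eps0.
near=> k.
have xkD : `|xk k - x| < D.
  by rewrite distrC; near: k; move/cvgrPdist_lt : xkx; apply.
have xD : `|x - x| < D by rewrite subrr normr0.
have qd1 : `|d - (tk k)^-1 *: (xk k - x)| < 1 by near: k; move/cvgrPdist_lt : qd; apply.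
have qdC : `|d - (tk k)^-1 *: (xk k - x)| < e / 2 / (C + 1).
  near: k; move/cvgrPdist_lt : qd; apply; rewrite !divr_gt0// ltr_wpDl//.
set q := (tk k)^-1 *: (xk k - x) in qd1 qdC.
have xkE : xk k - x = tk k *: q by rewrite scalerA divff ?gt_eqF// scale1r.
have := DP _ _ xkD xD; rewrite xkE innerZr normrZ gtr0_norm// => H.
have q_le : `|q| <= `|d| + 1.
  rewrite -(subrK d q) addrC (le_trans (ler_normD _ _))// lerD2l distrC.
  exact: ltW.
set a := phi (xk k) - phi x in H *.
have H1 : `|inner (grad phi x) q - (tk k)^-1 * a| <= e / 2.
  rewrite -(ler_pM2l (tk0 k)) -{1}(gtr0_norm (tk0 k)) -normrM mulrBr.
  rewrite mulVKf ?gt_eqF//.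
  rewrite distrC (le_trans H)// mulrCA ler_pM2l//.
  by rewrite mulrAC ler_pdivrMr// ler_pM2l// divr_gt0.
have H2 : `|inner (grad phi x) d - inner (grad phi x) q| < e / 2.
  rewrite -innerBr (le_lt_trans (inner_norm_le _ _))// -/C.
  apply: (@le_lt_trans _ _ ((C + 1) * `|d - q|)).
    by rewrite ler_wpM2r// lerDl.
  by rewrite mulrC -ltr_pdivlMr// ltr_wpDl.
have -> : inner (grad phi x) d - (tk k)^-1 * a =
  (inner (grad phi x) d - inner (grad phi x) q) +
  (inner (grad phi x) q - (tk k)^-1 * a) by rewrite addrA subrK.
rewrite (le_lt_trans (ler_normD _ _))// [e in _ < e](splitr e).
exact: ltr_leD.
Unshelve. all: by end_near. Qed.

Lemma of_class_C2_C1_at phi x : of_class_C 2 phi -> C1_at phi x.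
Proof.
move=> [dphi d2phi]; split => // i.
by have [/(_ x)/differentiable_continuous] := d2phi i.
Qed.

End TangentCone.

(** The corrected points lie within [e * t] of [x + t *: d] for every [e], so [d] is tangent. The
    neighbourhood [N] will carry the inactive constraints. *)
Lemma lyusternik (R : realType) (n : nat) (I : eqType) (r : seq I)
    (phi : I -> 'rV[R]_n -> R) (x d : 'rV[R]_n) (N : set 'rV[R]_n) :
  (forall i, i \in r -> C1_at (phi i) x) ->
  free [seq grad (phi i) x | i <- r] -> nbhs x N ->
  tangent_cone [set y | N y /\ exists2 t, 0 < t & forall i, i \in r ->
    phi i y = phi i x + t * inner (grad (phi i) x) d] x d.
Proof.
move=> phi_C1 phi_free /nbhs_normP[D /= D0 DN]; apply: tangent_cone_near => e e0.
have [T T0 TP] := lyusternik_correction phi_C1 phi_free d e0.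
have de_gt0 : 0 < `|d| + e by rewrite ltr_wpDl.
near (0 : R)^'+ => t.
have t0 : 0 < t by near: t; exact: nbhs_right_gt.
have tT : t < T by near: t; exact: nbhs_right_lt.
have te : t < e by near: t; exact: nbhs_right_lt.
have tD : t < D / (`|d| + e).
  by near: t; apply: nbhs_right_lt; rewrite divr_gt0.
exists t; first by rewrite t0.
have [|y yt yP] := TP t; first by rewrite t0.
exists y => //; split; last by exists t.
apply: DN => /=; rewrite distrC.
rewrite -(subrK (x + t *: d) y) -addrA (le_lt_trans (ler_normD _ _))//.
rewrite addrAC subrr add0r normrZ (gtr0_norm t0).
by move: tD; rewrite ltr_pdivlMr//; lra.
Unshelve. all: by end_near. Qed.

(** As [phi] vanishes at [x], its sign on [X] passes to the difference quotients and to their limit.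
    Localizing to [N] allows signs that hold only near [x]. *)
Lemma tangent_inner_ge0 (R : realType) (n : nat) (phi : 'rV[R]_n -> R)
    (X N : set 'rV[R]_n) x d : C1_at phi x -> phi x = 0 -> nbhs x N ->
  (forall y, N y -> X y -> 0 <= phi y) -> tangent_cone X x d ->
  0 <= inner (grad phi x) d.
Proof.
move=> phi_C1 phix0 xN NX [xk [tk [Xxk tk0 _ xkx qd]]].
have q_cvg := difference_quotient_cvg phi_C1 tk0 xkx qd.
rewrite -(cvg_lim _ q_cvg)//; apply: limr_ge; first exact: cvgP q_cvg.
have : \forall k \near \oo, N (xk k) by exact: xkx.
apply: filterS => k Nxk; rewrite phix0 subr0 mulr_ge0 ?NX//.
by rewrite invr_ge0 ltW.
Qed.

Lemma tangent_inner_eq0 (R : realType) (n : nat) (phi : 'rV[R]_n -> R)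
    (X N : set 'rV[R]_n) x d : C1_at phi x -> phi x = 0 -> nbhs x N ->
  (forall y, N y -> X y -> phi y = 0) -> tangent_cone X x d ->
  inner (grad phi x) d = 0.
Proof.
move=> phi_C1 phix0 xN NX [xk [tk [Xxk tk0 _ xkx qd]]].
have q_cvg := difference_quotient_cvg phi_C1 tk0 xkx qd.
rewrite -(cvg_lim _ q_cvg)//; apply: lim_near_cst => //.
have : \forall k \near \oo, N (xk k) by exact: xkx.
by apply: filterS => k Nxk; rewrite phix0 subr0 NX// mulr0.
Qed.

Lemma polar_coneS (R : realType) (n : nat) (M K : set 'rV[R]_n) :
  M `<=` K -> polar_cone K `<=` polar_cone M.
Proof. by move=> MK w Kw d /MK; exact: Kw. Qed.

(** * The constraints of the program as one indexed family *)

Section Mpbvc.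
Variables (R : realType) (n ng nh nH nG : nat) (P : mpbvc R n ng nh nH nG).
Hypothesis P_C2 : mpbvc_C2 P.
Variable x : 'rV[R]_n.
Hypothesis x_feasible : feasible P x.

(** A single index type lets the curve argument treat all four kinds of constraints at once. *)
Definition constraint_index : finType :=
  (('I_ng + 'I_nh) + ('I_nH + 'I_nH * 'I_nG))%type.

Definition constraint (i : constraint_index) : 'rV[R]_n -> R :=
  match i with
  | inl (inl k) => eqc_comp P k
  | inl (inr l) => ineqc_comp P l
  | inr (inl i) => Hc P i
  | inr (inr ij) => Gc P ij.1 ij.2
  end.

(** Listed in the order of the family in [BVC_LICQ], so that freeness carries over by mapping
    alone. *)
Definition licq_index : seq constraint_index :=
  [seq inl (inl k) | k : 'I_ng] ++ [seq inl (inr l) | l in I_h P x]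
  ++ [seq inr (inl i) | i in I0_H P x]
  ++ [seq inr (inr ij) | ij in (I_00 P x :|: I_p0 P x)%SET].

Lemma licq_indexE i : i \in licq_index =
  match i with
  | inl (inl k) => true
  | inl (inr l) => l \in I_h P x
  | inr (inl i) => i \in I0_H P x
  | inr (inr ij) => ij \in (I_00 P x :|: I_p0 P x)%SET
  end.
Proof.
have notin (T : finType) (A : {pred T}) (f : T -> constraint_index) :
    (forall t, f t <> i) -> (i \in [seq f t | t in A]) = false.
  by move=> fi; apply/negP => /mapP[t _ /esym/fi].
have isin (T : finType) (A : {pred T}) (f : T -> constraint_index) t :
    injective f -> f t = i -> (i \in [seq f t | t in A]) = (t \in A).
  by move=> f_inj <-; rewrite mem_map// mem_enum.
rewrite /licq_index !mem_cat.
case: i notin isin => [[k|l]|[i|ij]] notin isin.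
- by rewrite (isin _ _ _ k)// => ? ? [].
- by rewrite notin// (isin _ _ _ l) ?notin ?orbF// => ? ? [].
- by rewrite notin// notin// (isin _ _ _ i) ?notin ?orbF// => ? ? [].
- by rewrite notin// notin// notin// (isin _ _ _ ij)// => ? ? [].
Qed.

Lemma BVC_LICQ_free : BVC_LICQ P x ->
  free [seq grad (constraint i) x | i <- licq_index].
Proof.
by rewrite !map_cat -!(map_comp (fun i : constraint_index => grad (constraint i) x)).
Qed.

Lemma constraint_C1 i : C1_at (constraint i) x.
Proof.
case: P_C2 => _ gC2 hC2 HC2 GC2.
apply: of_class_C2_C1_at; case: i => [[k|l]|[i|ij]].
- exact: gC2.
- exact: hC2.
- exact: HC2.
- exact: GC2.
Qed.

Lemma constraint_cvg i : {for x, continuous (constraint i)}.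
Proof. by have [/(_ x)/differentiable_continuous] := constraint_C1 i. Qed.

Lemma constraint_gt0 i : 0 < constraint i x -> \forall y \near x, 0 < constraint i y.
Proof. exact: (cvgr_gt _ (@constraint_cvg i)). Qed.

Lemma constraint_lt0 i : constraint i x < 0 -> \forall y \near x, constraint i y < 0.
Proof. exact: (cvgr_lt _ (@constraint_cvg i)). Qed.

Lemma mem_proj_H (A : {set 'I_nH * 'I_nG}) i :
  reflect (exists j, (i, j) \in A) (i \in proj_H A).
Proof. by rewrite inE; exact: existsP. Qed.

(** * Comparison of the tangent and linearized cones *)

Lemma tangent_cone_linearized :
  tangent_cone (feasible P) x `<=` linearized_cone P x.
Proof.
have [gx hx Hx GHx] := x_feasible.
move=> d dT; split.
- move=> k; apply: (tangent_inner_eq0 (constraint_C1 (inl (inl k))) _ filterT _ dT).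
    by rewrite /= /eqc_comp gx mxE.
  by move=> y _ [gy _ _ _]; rewrite /= /eqc_comp gy mxE.
- move=> l; rewrite inE => /eqP hl0.
  apply: (tangent_inner_ge0 (constraint_C1 (inl (inr l))) _ filterT _ dT) => //.
  by move=> y _ [_ hy _ _]; exact: hy.
(* Near [x] the factor [G] stays negative, so feasibility forces [H] to vanish there. *)
- move=> i /mem_proj_H[j]; rewrite inE => /andP[/eqP /= Hi0 Gij].
  apply: (tangent_inner_eq0 (constraint_C1 (inr (inl i))) _
    (constraint_lt0 (i := inr (inr (i, j))) Gij) _ dT) => //.
  move=> y /= Gy [_ _ /(_ i) Hy /(_ i j)]; rewrite nmulr_rge0// => Hy'.
  by apply/eqP; rewrite eq_le Hy' Hy.
- move=> i; rewrite inE => iI.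
  have Hi0 : Hc P i x = 0.
    by case/orP: iI => /mem_proj_H[j]; rewrite inE => /andP[/eqP].
  apply: (tangent_inner_ge0 (constraint_C1 (inr (inl i))) _ filterT _ dT) => //.
  by move=> y _ [_ _ Hy _]; exact: Hy.
(* Near [x] the factor [H] stays positive, so feasibility forces [G] to be nonnegative. *)
- move=> i j; rewrite inE => /andP[/= Hi /eqP Gij].
  apply: (tangent_inner_ge0 (constraint_C1 (inr (inr (i, j)))) _
    (constraint_gt0 (i := inr (inl i)) Hi) _ dT) => //.
  by move=> y /= Hy [_ _ _ /(_ i j)]; rewrite pmulr_lge0.
Qed.

(** Along the Lyusternik curve feasibility becomes a check of signs. The delicate pairs are those in
    [I_00], where the product [G * H] is [t ^ 2] times the product of the two derivatives; either
    branch makes it nonnegative. *)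
Lemma linearized_branch_tangent d : (0 < nG)%N -> BVC_LICQ P x ->
  linearized_cone P x d ->
  (forall i j, (i, j) \in I_00 P x -> 0 <= inner (grad (Gc P i j) x) d) \/
  (forall i, i \in I0_H P x -> inner (grad (Hc P i) x) d = 0) ->
  tangent_cone (feasible P) x d.
Proof.
move=> nG_gt0 /BVC_LICQ_free licq [dg dh dH0 dH dG] branch.
have [gx hx Hx GHx] := x_feasible.
have Ninact : \forall y \near x, forall i, 0 < constraint i x -> 0 < constraint i y.
  have H i : \forall y \near x, 0 < constraint i x -> 0 < constraint i y.
      have [i_gt0|_] := boolP (0 < constraint i x); last by near=> y.
    by near=> y => _; near: y; exact: constraint_gt0.
  exact: (filter_forall _ H).
apply: tangent_coneS (lyusternik d (fun i _ => constraint_C1 i) licq Ninact).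
move=> y [y_inact [t t0 y_act]].
have gy k : eqc P y 0 k = 0.
  have := y_act (inl (inl k)); rewrite licq_indexE /= dg mulr0 addr0 /eqc_comp.
  by rewrite gx mxE; exact.
have hy l : 0 <= ineqc P y 0 l.
  have [hl0|hl_neq0] := eqVneq (ineqc P x 0 l) 0; last first.
    by apply/ltW/(y_inact (inl (inr l))); rewrite /= lt_neqAle eq_sym hl_neq0 hx.
  have lI : l \in I_h P x by rewrite inE hl0.
  have := y_act (inl (inr l)); rewrite licq_indexE lI /= /ineqc_comp hl0 add0r.
  by move=> ->//; rewrite mulr_ge0 ?dh// ltW.
have HyE i : Hc P i x = 0 -> Hc P i y = t * inner (grad (Hc P i) x) d.
  move=> Hi0; have := y_act (inr (inl i)); rewrite licq_indexE inE /= Hi0 eqxx add0r.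
  exact.
have GyE i j : Gc P i j x = 0 -> Gc P i j y = t * inner (grad (Gc P i j) x) d.
  move=> Gij0; have := y_act (inr (inr (i, j))).
  rewrite licq_indexE !inE /= Gij0 eqxx !andbT add0r; apply.
  by rewrite eq_sym -le_eqVlt.
have Hy_gt0 i : 0 < Hc P i x -> 0 < Hc P i y by exact: (y_inact (inr (inl i))).
have Gy_gt0 i j : 0 < Gc P i j x -> 0 < Gc P i j y.
  exact: (y_inact (inr (inr (i, j)))).
have Hy i : 0 <= Hc P i y.
  have [Hi0|Hi_neq0] := eqVneq (Hc P i x) 0; last first.
    by apply/ltW/Hy_gt0; rewrite lt_neqAle eq_sym Hi_neq0 Hx.
  (* Some [j] exists, and the sign of [G] at [(i, j)] puts [i] into one of the three projected sets,
     each of which controls the derivative of [H]. *)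
  rewrite HyE// mulr_ge0 ?(ltW t0)//; pose j := Ordinal nG_gt0.
  have [Gij|Gij|Gij] := ltgtP (Gc P i j x) 0.
  - rewrite dH0//; apply/mem_proj_H; exists j.
    by rewrite inE /= Hi0 eqxx Gij.
  - apply: dH; rewrite inE; apply/orP; right; apply/mem_proj_H; exists j.
    by rewrite inE /= Hi0 eqxx Gij.
  - apply: dH; rewrite inE; apply/orP; left; apply/mem_proj_H; exists j.
    by rewrite inE /= Hi0 eqxx Gij eqxx.
split => //; first by apply/rowP => k; rewrite gy mxE.
move=> i j; have [Hi0|Hi_neq0] := eqVneq (Hc P i x) 0; last first.
  have Hi : 0 < Hc P i x by rewrite lt_neqAle eq_sym Hi_neq0 Hx.
  have := GHx i j; rewrite pmulr_lge0// le_eqVlt => /orP[/eqP Gij0|Gij].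
    rewrite mulr_ge0// GyE// mulr_ge0 ?(ltW t0)//; apply: dG.
    by rewrite inE /= Hi -Gij0 eqxx.
  by rewrite mulr_ge0// ltW// Gy_gt0.
have [Gij|Gij|Gij] := ltgtP (Gc P i j x) 0.
(* Here [H] is stationary along [d], hence zero on the curve, and the negative [G] does no harm. *)
- rewrite HyE// dH0 ?mulr0//; apply/mem_proj_H; exists j.
  by rewrite inE /= Hi0 eqxx Gij.
- by rewrite mulr_ge0// ltW// Gy_gt0.
- case: branch => [dG0|dH00].
    rewrite mulr_ge0// GyE// mulr_ge0 ?(ltW t0)//; apply: dG0.
    by rewrite inE /= Hi0 Gij !eqxx.
  by rewrite HyE// dH00 ?mulr0// inE Hi0 eqxx.
Unshelve. all: by end_near. Qed.

(* [d = (d + e) - e], where [e] cancels the negative derivatives along [d] of the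
   [G] indexed by [I_00] and is orthogonal to every other active gradient. *)
Lemma linearized_cone_split d : (0 < nG)%N -> BVC_LICQ P x ->
  linearized_cone P x d -> exists d1 d2,
    [/\ d = d1 + d2, tangent_cone (feasible P) x d1
      & tangent_cone (feasible P) x d2].
Proof.
move=> nG_gt0 licq dL; have [dg dh dH0 dH dG] := dL.
(* The negative part of the derivative of [G] along [d] on [I_00], and 0 elsewhere. *)
pose c (i : constraint_index) : R := if i is inr (inr ij) then
  if ij \in I_00 P x then Num.max 0 (- inner (grad (Gc P ij.1 ij.2) x) d) else 0
  else 0.
have [e eP] := free_interpolation c (BVC_LICQ_free licq).
have eg k : inner (grad (eqc_comp P k) x) e = 0.
  by have := eP (inl (inl k)); rewrite licq_indexE; exact.
have eh l : l \in I_h P x -> inner (grad (ineqc_comp P l) x) e = 0.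
  by have := eP (inl (inr l)); rewrite licq_indexE.
have eH i : i \in I0_H P x -> inner (grad (Hc P i) x) e = 0.
  by have := eP (inr (inl i)); rewrite licq_indexE.
(* [I_p0] and [I_00] are disjoint, by the sign of [H], so the prescribed value is 0. *)
have eGp0 i j : (i, j) \in I_p0 P x -> inner (grad (Gc P i j) x) e = 0.
  have := eP (inr (inr (i, j))); rewrite licq_indexE inE /= => + ijp0.
  rewrite ijp0 orbT => ->//; case: ifP => //; move: ijp0; rewrite !inE /=.
  by move=> /andP[/gt_eqF ->].
have eG00 i j : (i, j) \in I_00 P x ->
    inner (grad (Gc P i j) x) e = Num.max 0 (- inner (grad (Gc P i j) x) d).
  by have := eP (inr (inr (i, j))); rewrite licq_indexE inE /= => + ij00;
    rewrite ij00; exact.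
have projI0 i (A : {set 'I_nH * 'I_nG}) :
    (forall j, (i, j) \in A -> Hc P i x == 0) -> i \in proj_H A -> i \in I0_H P x.
  by move=> AP /mem_proj_H[j /AP]; rewrite inE.
have e00 i : i \in (proj_H (I_00 P x) :|: proj_H (I_0p P x))%SET -> i \in I0_H P x.
  by rewrite inE => /orP[] /projI0; apply => j; rewrite inE => /andP[].
have e0m i : i \in proj_H (I_0m P x) -> i \in I0_H P x.
  by move=> /projI0; apply => j; rewrite inE => /andP[].
exists (d + e), (- e); split; first by rewrite addrK.
- apply: linearized_branch_tangent => //.
    split => [k|l lI|i iI|i iI|i j ijI]; rewrite innerDr.
    + by rewrite dg eg addr0.
    + by rewrite eh// addr0 dh.
    + by rewrite dH0// eH ?addr0// e0m.
    + by rewrite (eH i) ?addr0 ?dH// e00.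
    + by rewrite eGp0// addr0 dG.
  left=> i j ijI; rewrite innerDr eG00//.
  by rewrite -lerBlDl sub0r le_max lexx orbT.
(* Every derivative that the linearized cone restricts vanishes along [e], so [- e] belongs to it
   too, and all active [H] are stationary. *)
- apply: linearized_branch_tangent => //.
    split => [k|l lI|i iI|i iI|i j ijI]; rewrite innerNr.
    + by rewrite eg oppr0.
    + by rewrite eh// oppr0.
    + by rewrite eH ?oppr0// e0m.
    + by rewrite (eH i) ?oppr0// e00.
    + by rewrite eGp0// oppr0.
  by right=> i iI; rewrite innerNr eH// oppr0.
Qed.

End Mpbvc.

(** * Equality of the polar cones *)

Theorem mainTheorem1 (R : realType) (n ng nh nH nG : nat)
    (nH_gt0 : (0 < nH)%N) (nG_gt0 : (0 < nG)%N)
    (P : mpbvc R n ng nh nH nG) (P_C2 : mpbvc_C2 P)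
    (xstar : 'rV[R]_n) (xstar_feasible : feasible P xstar)
    (licq : BVC_LICQ P xstar) :
  GCQ P xstar.
Proof.
apply/seteqP; split => [|w wT d dL].
  exact/polar_coneS/tangent_cone_linearized.
(* The tangent cone need not be convex, but the inequality defining its polar adds up over the two
   tangent summands. *)
have [d1 [d2 [-> d1T d2T]]] :=
  linearized_cone_split P_C2 xstar_feasible nG_gt0 licq dL.
by rewrite innerDr -[leRHS]addr0 lerD ?wT//.
Qed.
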